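(* Let $d\ge 1$ and $q>2$ be integers and let $W$ be a walk in the Hamming graph $H(d,q)$ that starts and ends at the origin $\mathbf{0}=(0,\ldots,0)$. Then $W$ is equivalent to a walk $W'$ that is a product (concatenation) of ground walks; that is, $W$ is generated by the ground walks.
   Context: The Hamming graph $H(d,q)$ has vertex set $\{(x_1,\ldots,x_d): x_i\in S\}$ with $S=\{0,1,\ldots,q-1\}$, and two vertices are adjacent if and only if they differ in exactly one coordinate. A walk of length $n$ in a graph is a sequence of vertices $(v_0v_1\cdots v_n)$ with $v_i$ adjacent to $v_{i+1}$ for all $0\le i<n$. For $1\le i\le d$, a ground walk in the $i$th coordinate is a closed walk of length three $U_i=(\mathbf{0}\,(0,\ldots,a_i,\ldots,0)\,(0,\ldots,b_i,\ldots,0)\,\mathbf{0})$, where $a_i,b_i$ are placed in the $i$th coordinate and all other coordinates are $0$ (so $a_i,b_i$ are nonzero and distinct); the reverse of a ground walk is again a ground walk. Two walks are equivalent, written $\simeq$ (homotopic rel endpoints for $\times$-homotopy), if one can be transformed into the other by a finite sequence of the following moves: (1) spider moves: replacing a single interior vertex $v_k$ ($0<k<n$) of a walk by another vertex $v_k'$ such that the result is again a walk (so $v_k'$ is adjacent to both $v_{k-1}$ and $v_{k+1}$); (2) prunes: if $v_i=v_{i+2}$, deleting the entries $v_i,v_{i+1}$ from the walk; (3) anti-prunes: the inverse operation of a prune. *)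

(* Defs.v *)
From Stdlib Require Import Relation_Operators.
From mathcomp Require Import all_boot.
Set Implicit Arguments. Unset Strict Implicit. Unset Printing Implicit Defensive.

Section Walks.
Variables (T : eqType) (e : rel T).

(* A walk of length n is its sequence of n + 1 vertices, hence never empty. *)
Definition is_walk (w : seq T) : bool :=
  if w is v :: s then path e v s else false.

Inductive spider_move : seq T -> seq T -> Prop :=
  SpiderMove p u x x' v r :
    is_walk (p ++ [:: u, x, v & r]) -> is_walk (p ++ [:: u, x', v & r]) ->
    spider_move (p ++ [:: u, x, v & r]) (p ++ [:: u, x', v & r]).

Inductive prune : seq T -> seq T -> Prop :=
  Prune p x y r :
    is_walk (p ++ [:: x, y, x & r]) ->
    prune (p ++ [:: x, y, x & r]) (p ++ x :: r).

Inductive move (w w' : seq T) : Prop :=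
  | MoveSpider of spider_move w w'
  | MovePrune of prune w w'
  | MoveAntiPrune of prune w' w.

Definition walk_equiv : seq T -> seq T -> Prop := clos_refl_trans (seq T) move.

(* Meaningful when the last vertex of w is the first vertex of w'; that vertex
   is then kept only once. *)
Definition walk_cat (w w' : seq T) : seq T := w ++ behead w'.

(* The empty product of closed walks at v is the walk of length 0 at v. *)
Definition walk_prod (v : T) (ws : seq (seq T)) : seq T :=
  foldr walk_cat [:: v] ws.

End Walks.

Section Hamming.
Variables d q : nat.

Definition vertex := {ffun 'I_d -> 'I_q}.

Definition hamming_adj : rel vertex :=
  fun x y => #|[set i | x i != y i]| == 1.

Hypothesis q_gt2 : 2 < q.

Definition zero : 'I_q := Ordinal (ltnW (ltnW q_gt2)).

Definition origin : vertex := [ffun=> zero].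

Definition on_axis (i : 'I_d) (a : 'I_q) : vertex :=
  [ffun j => if j == i then a else zero].

(* That a and b are nonzero and distinct is forced by the walk condition. *)
Definition ground_walk (U : seq vertex) : Prop :=
  is_walk hamming_adj U /\
  exists (i : 'I_d) (a b : 'I_q),
    U = [:: origin; on_axis i a; on_axis i b; origin].

Definition ground_walk_product (W : seq vertex) : Prop :=
  exists2 Us : seq (seq vertex),
    (forall U, U \in Us -> ground_walk U) & W = walk_prod origin Us.

End Hamming.

(* Main.v *)
From Stdlib Require Import Relation_Operators.
Require Import Defs.
From mathcomp Require Import all_boot.

(** To each vertex x attach the canonical path P(x) from the origin to x that
    sets the nonzero coordinates of x one after the other, in a fixed order.
    Reading a closed walk from left to right, one keeps it in the form
    P(x) followed by the walk that remains to be read from x, with ground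
    walks accumulating in front.  So everything rests on one edge (x, y), with
    x and y differing in the coordinate i: the walk P(x) y is homotopic to
    P(y), possibly preceded by a ground walk in the coordinate i
    ([canonical_path_edge]).

    The reason is that edges in different coordinates span squares, and a
    spider move pushes a walk across a square.  Hence an edge in the direction
    i can be slid back along any walk that does not move in the direction i
    ([slide_edge]).  Sliding the edge (x, y) back along the end of P(x) takes
    it to the moment when P(x) sets the coordinate i; let v be the vertex
    reached just before.  If x or y has coordinate i zero, what remains is
    P(y), up to a prune.  Otherwise an anti-prune splits off a triangle based
    at v in the direction i, and its three edges slide back to the origin
    ([slide_triangle]), where the triangle becomes a ground walk.  At the end
    of the closed walk x is the origin, P(x) has length 0, and only ground
    walks are left. *)

Set Implicit Arguments. Unset Strict Implicit. Unset Printing Implicit Defensive.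

(** * Homotopy of pieces of walks *)

Section Homotopy.
Variables (T : eqType) (e : rel T).
Hypothesis e_sym : symmetric e.

(** Equivalence of walks is not visibly compatible with concatenation, since
    each of its moves carries walk conditions on the whole walk.  Quantifying
    over the contexts p and s, and letting the walk condition travel from left
    to right, makes compatibility immediate. *)
Definition homotopic (w w' : seq T) : Prop :=
  forall p s, is_walk e (p ++ w ++ s) ->
    is_walk e (p ++ w' ++ s) /\ walk_equiv e (p ++ w ++ s) (p ++ w' ++ s).

Lemma homotopic_refl w : homotopic w w.
Proof. by move=> p s Hw; split=> //; apply: rt_refl. Qed.

Lemma homotopic_trans w2 w1 w3 :
  homotopic w1 w2 -> homotopic w2 w3 -> homotopic w1 w3.
Proof.
move=> H12 H23 p s /H12[/H23[W3 E23] E12]; split=> //.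
exact: rt_trans E12 E23.
Qed.

Lemma homotopic_cat w1 w1' w2 w2' :
  homotopic w1 w1' -> homotopic w2 w2' -> homotopic (w1 ++ w2) (w1' ++ w2').
Proof.
move=> H1 H2; apply: (@homotopic_trans (w1' ++ w2)) => p s.
  by rewrite -!catA; apply: H1.
by have := H2 (p ++ w1') s; rewrite -!catA.
Qed.

Lemma homotopic_catl w w1 w2 :
  homotopic w1 w2 -> homotopic (w ++ w1) (w ++ w2).
Proof. by move=> H; apply: homotopic_cat => //; apply: homotopic_refl. Qed.

Lemma homotopic_catr w w1 w2 :
  homotopic w1 w2 -> homotopic (w1 ++ w) (w2 ++ w).
Proof. by move=> H; apply: homotopic_cat => //; apply: homotopic_refl. Qed.

Lemma homotopic_cons x w1 w2 :
  homotopic w1 w2 -> homotopic (x :: w1) (x :: w2).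
Proof. exact: (homotopic_catl (w := [:: x])). Qed.

Lemma homotopic_after u s t1 t2 :
  homotopic (last u s :: t1) (last u s :: t2) ->
  homotopic (u :: s ++ t1) (u :: s ++ t2).
Proof. by rewrite -!cat_cons (lastI u s) !cat_rcons; apply: homotopic_catl. Qed.

Lemma is_walk_cat_cons p x r :
  is_walk e (p ++ x :: r) = is_walk e (rcons p x) && path e x r.
Proof.
by case: p => //= y p; rewrite cat_path rcons_path /= andbA.
Qed.

Lemma homotopic_spider u x x' v :
  e u x' -> e x' v -> homotopic [:: u; x; v] [:: u; x'; v].
Proof.
move=> ux' x'v p s W1.
have W2 : is_walk e (p ++ [:: u, x', v & s]).
  by move: W1; rewrite !is_walk_cat_cons /= ux' x'v => /and4P[-> _ _ ->].
by split=> //; apply/rt_step/MoveSpider; apply: SpiderMove.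
Qed.

Lemma homotopic_prune x y : homotopic [:: x; y; x] [:: x].
Proof.
move=> p s W1; split; last by apply/rt_step/MovePrune; apply: Prune.
by move: W1; rewrite !is_walk_cat_cons /= => /and4P[-> _ _ ->].
Qed.

Lemma homotopic_antiprune x y : e x y -> homotopic [:: x] [:: x; y; x].
Proof.
move=> xy p s W1.
have W2 : is_walk e (p ++ [:: x, y, x & s]).
  by move: W1; rewrite !is_walk_cat_cons /= (e_sym y) xy.
by split=> //; apply/rt_step/MoveAntiPrune; apply: Prune.
Qed.

End Homotopy.

Arguments homotopic_trans {T e} w2 {w1 w3} _ _.
Arguments homotopic_catl {T e} w {w1 w2} _.
Arguments homotopic_catr {T e} w {w1 w2} _.
Arguments homotopic_cons {T e} x {w1 w2} _.

(** * Sliding edges and triangles in Hamming graphs *)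

Section Hamming.
Variables d q : nat.
Implicit Types (x y u v : vertex d q) (i j : 'I_d) (a b c : 'I_q).
Implicit Types (s U W : seq (vertex d q)) (cs : seq 'I_d).
Local Notation adj := (@hamming_adj d q).
Local Notation homotopic := (homotopic adj).

Definition set_coord i a x : vertex d q :=
  [ffun j => if j == i then a else x j].

Lemma set_coordK i a b x : set_coord i b (set_coord i a x) = set_coord i b x.
Proof. by apply/ffunP=> j; rewrite !ffunE; case: eqP. Qed.

Lemma set_coord_id i x : set_coord i (x i) x = x.
Proof. by apply/ffunP=> j; rewrite ffunE; case: eqP => [->|]. Qed.

Lemma set_coordC i j a b x : i != j ->
  set_coord i a (set_coord j b x) = set_coord j b (set_coord i a x).
Proof.
move=> /negPf ij; apply/ffunP=> k; rewrite !ffunE.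
by case: eqP => // ->; rewrite ij.
Qed.

Lemma adj_sym : symmetric adj.
Proof.
by move=> x y; rewrite /hamming_adj; congr (_ == 1); apply: eq_card => i;
   rewrite !inE eq_sym.
Qed.

Lemma adj_set_coord2 i a b x : a != b -> adj (set_coord i a x) (set_coord i b x).
Proof.
move=> ab; apply/cards1P; exists i; apply/setP=> j.
by rewrite !inE !ffunE; case: (j == i); rewrite ?eqxx.
Qed.

Lemma adj_set_coord i b x : x i != b -> adj x (set_coord i b x).
Proof. by move/(adj_set_coord2 i x); rewrite set_coord_id. Qed.

Lemma adjE x y : adj x y -> exists2 i, x i != y i & y = set_coord i (y i) x.
Proof.
move=> /cards1P[i Dxy]; exists i; first by have := set11 i; rewrite -Dxy inE.
apply/ffunP=> j; rewrite ffunE; case: eqP => [-> //|/eqP ji].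
have : j \notin [set i] by rewrite inE.
by rewrite -Dxy inE negbK => /eqP.
Qed.

Lemma adj_parallel i b x y : x i = y i -> adj x y ->
  adj (set_coord i b x) (set_coord i b y).
Proof.
move=> xyi; rewrite /hamming_adj; congr (_ == 1); apply: eq_card => j.
by rewrite !inE !ffunE; case: (eqVneq j i) => [->|//]; rewrite xyi !eqxx.
Qed.

(** The walk and its translate in the direction i bound a strip of squares; one
    spider move crosses each of them. *)
Lemma slide_edge i a b u s :
  b != a -> path adj u s -> all (fun v => v i == a) (u :: s) ->
  homotopic (u :: rcons s (set_coord i b (last u s)))
            (u :: map (set_coord i b) (u :: s)).
Proof.
move=> ba; elim: s u => [|v s IHs] u /=; first by move=> *; apply: homotopic_refl.
case/andP=> uv vs /and3P[/eqP ua /eqP va sa].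
have := IHs v vs; rewrite /= va eqxx sa => /(_ isT) IH.
apply: homotopic_trans _ (homotopic_cons u IH) _.
apply: (homotopic_catr _ (w1 := [:: u; v; set_coord i b v])
                       (w2 := [:: u; set_coord i b u; set_coord i b v])).
apply: homotopic_spider; first by rewrite adj_set_coord // ua eq_sym.
by apply: adj_parallel; rewrite ?ua ?va.
Qed.

(** The three edges of the triangle slide one after the other: the first along
    the walk itself, the other two along its translates in the direction i. *)
Lemma slide_triangle i a b c u s :
  a != c -> b != a -> c != b ->
  path adj u s -> all (fun v => v i == c) (u :: s) ->
  let l := last u s in
  homotopic (u :: s ++ [:: set_coord i a l; set_coord i b l; l])
            [:: u, set_coord i a u, set_coord i b u, u & s].
Proof.
move=> ac ba cb us usc l.
have pathM t : path adj (set_coord i t u) (map (set_coord i t) s).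
  elim: s u us usc {l} => //= v s IHs u /andP[uv vs] /and3P[/eqP uc /eqP vc sc].
  rewrite IHs ?vc ?eqxx ?sc // andbT.
  by apply: adj_parallel; rewrite ?uc ?vc.
have allM t : all (fun v => v i == t)
    (set_coord i t u :: map (set_coord i t) s).
  by rewrite -map_cons all_map; apply/allP => v _ /=; rewrite ffunE eqxx.
have slideM t t' : t' != t ->
    homotopic (rcons (map (set_coord i t) (u :: s)) (set_coord i t' l))
              (set_coord i t u :: map (set_coord i t') (u :: s)).
  move=> t't; have := slide_edge t't (pathM t) (allM t).
  rewrite last_map set_coordK /= set_coordK -map_comp.
  by have -> // :=
    @eq_map _ _ (set_coord i t' \o set_coord i t) _ (set_coordK i t t').
have mapc : map (set_coord i c) (u :: s) = u :: s.
  rewrite -[RHS]map_id; apply/eq_in_map => v vus.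
  by rewrite -(eqP (allP usc v vus)) set_coord_id.
have lc : set_coord i c l = l.
  by rewrite -(eqP (allP usc l (mem_last u s))) set_coord_id.
have S1 := slide_edge ac us usc.
have S2 := slideM a b ba.
have S3 := slideM b c cb.
rewrite mapc lc in S3.
rewrite -cats1 in S1; rewrite -!cats1 in S2 S3.
have := homotopic_catr [:: set_coord i b l; l] S1; rewrite /= -catA => C1.
have := homotopic_cons u (homotopic_catr [:: l] S2); rewrite /= -catA => C2.
have C3 := homotopic_cons u (homotopic_cons (set_coord i a u) S3).
exact: homotopic_trans _ C1 (homotopic_trans _ C2 C3).
Qed.

(** * Canonical paths *)

Fixpoint canonical_path u x cs : seq (vertex d q) :=
  if cs is i :: cs' then
    if u i == x i then canonical_path u x cs'
    else let u' := set_coord i (x i) u in u' :: canonical_path u' x cs'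
  else [::].

Lemma canonical_path_cat u x cs1 cs2 :
  canonical_path u x (cs1 ++ cs2) =
  canonical_path u x cs1 ++
  canonical_path (last u (canonical_path u x cs1)) x cs2.
Proof. by elim: cs1 u => //= i cs IH u; case: eqP => _; rewrite IH. Qed.

Lemma canonical_path_walk u x cs : path adj u (canonical_path u x cs).
Proof.
elim: cs u => //= i cs IH u; case: eqP => [_|/eqP neq]; first exact: IH.
by rewrite /= IH adj_set_coord.
Qed.

Lemma last_canonical_path u x cs j :
  last u (canonical_path u x cs) j = if j \in cs then x j else u j.
Proof.
elim: cs u => //= i cs IH u; rewrite inE.
case: eqP => [uxi|_]; rewrite /= IH ?ffunE; case: (j \in cs); rewrite ?orbT //;
  by case: eqP => // ->.
Qed.

Lemma eq_canonical_path u x y cs :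
  {in cs, x =1 y} -> canonical_path u x cs = canonical_path u y cs.
Proof.
elim: cs u => //= i cs IH u xy; rewrite xy ?mem_head //.
have xy' : {in cs, x =1 y} by move=> j jcs; apply: xy; rewrite inE jcs orbT.
by rewrite !IH.
Qed.

Lemma canonical_path_constant u x cs i : i \notin cs ->
  all (fun v => v i == u i) (u :: canonical_path u x cs).
Proof.
elim: cs u => [|j cs IH] u /=; first by rewrite eqxx.
rewrite inE negb_or => /andP[/negPf ij ics]; case: (u j =P x j) => _.
  exact: IH u ics.
rewrite eqxx; have := IH (set_coord j (x j) u) ics.
by rewrite !ffunE ij.
Qed.

Lemma map_canonical_path i b u x cs : i \notin cs ->
  map (set_coord i b) (canonical_path u x cs) =
  canonical_path (set_coord i b u) x cs.
Proof.
elim: cs u => //= j cs IH u; rewrite inE negb_or => /andP[ij ics].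
rewrite !ffunE (eq_sym j) (negPf ij); case: eqP => _; first exact: IH.
by rewrite /= IH // set_coordC.
Qed.

Lemma canonical_path_refl u cs : canonical_path u u cs = [::].
Proof. by elim: cs => //= i cs ->; rewrite eqxx. Qed.

(** The edge from x to [set_coord i b x] slides back along the steps that follow
    the coordinate i.  Writing v for the vertex reached just before i is set,
    it then forms with v a triangle in the direction i, which degenerates
    when x i or b is already the value u i of v at i; otherwise
    the triangle is carried back to u.  The prefix t is empty or this triangle
    without its return to u, the path after t starting with u. *)
Lemma canonical_path_edge u x i b cs :
  uniq cs -> (forall j, j \in cs) -> x i != b ->
  exists2 t, t = [::] \/
      [/\ t = [:: u; set_coord i (x i) u; set_coord i b u],
          x i != u i & b != u i] &
    homotopic (u :: rcons (canonical_path u x cs) (set_coord i b x))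
              (t ++ u :: canonical_path u (set_coord i b x) cs).
Proof.
move=> Ucs cs_full xib; have ics := cs_full i.
case/splitPr: ics Ucs cs_full => c1 c2.
rewrite cat_uniq /= => /and4P[_]; rewrite negb_or => /andP[ic1 _] ic2 _ cs_full.
set y := set_coord i b x.
have y_off (cs' : seq 'I_d) : i \notin cs' -> {in cs', y =1 x}.
  by move=> ic j jc; rewrite ffunE; case: eqP jc ic => // -> ->.
have yi : y i = b by rewrite ffunE eqxx.
rewrite !canonical_path_cat (eq_canonical_path u (y_off _ ic1)) rcons_cat.
have p1 := canonical_path_walk u x c1.
have k1 := canonical_path_constant u x ic1.
set P1 := canonical_path u x c1 in p1 k1 *; set v := last u P1.
have vi : v i = u i by rewrite /v last_canonical_path (negPf ic1).
pose va := set_coord i (x i) v; pose vb := set_coord i b v.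
(* Both paths reach the coordinate i at v; the edge to y moves back from the
   end of the first path to va. *)
have slide2 :
    homotopic (va :: rcons (canonical_path va x c2) y)
              (va :: vb :: canonical_path vb y c2).
  have vai : va i = x i by rewrite ffunE eqxx.
  have k2 := canonical_path_constant va x ic2; rewrite vai in k2.
  have := slide_edge (b := b) _ (canonical_path_walk va x c2) k2.
  rewrite eq_sym xib => /(_ isT); rewrite /= map_canonical_path // set_coordK.
  rewrite -/vb (eq_canonical_path vb (y_off _ ic2)).
  suff -> : set_coord i b (last va (canonical_path va x c2)) = y by [].
  apply/ffunP=> j; rewrite !ffunE last_canonical_path; case: eqP => // /eqP ji.
  case: ifP => // jc2; rewrite ffunE (negPf ji) last_canonical_path.
  by have := cs_full j; rewrite mem_cat inE (negPf ji) jc2 /= orbF => ->.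
rewrite /= vi yi; case: (eqVneq (u i) (x i)) => [uxi|uxi].
  have va_v : va = v by rewrite /va -uxi -vi set_coord_id.
  exists [::]; first by left.
  rewrite uxi (negPf xib) /=; apply: homotopic_after.
  by rewrite va_v in slide2.
case: (eqVneq (u i) b) => [ub|ub].
  have vb_v : vb = v by rewrite /vb -ub -vi set_coord_id.
  exists [::]; first by left.
  apply: homotopic_after; apply: homotopic_trans _ (homotopic_cons v slide2) _.
  rewrite vb_v; apply: (homotopic_catr _ (w1 := [:: v; va; v]) (w2 := [:: v])).
  exact: homotopic_prune.
exists [:: u; set_coord i (x i) u; set_coord i b u].
  by right.
(* The path va vb is replaced with va vb v vb, so that v va vb v is closed. *)
have := slide_triangle (a := x i) _ _ ub p1 k1.
rewrite (eq_sym (x i)) (eq_sym b) uxi xib => /(_ isT isT).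
rewrite -/v -/va -/vb /= => tri.
apply: homotopic_trans _ (homotopic_catr (vb :: canonical_path vb y c2) tri).
rewrite /= -catA /=; apply: homotopic_after; apply: homotopic_cons.
apply: homotopic_trans _ slide2 _; apply: homotopic_cons.
apply: (homotopic_catr _ (w1 := [:: vb]) (w2 := [:: vb; v; vb])).
by apply: (homotopic_antiprune adj_sym); rewrite adj_sym adj_set_coord // vi.
Qed.

(** * Ground walks *)

Hypothesis hq : 2 < q.
Local Notation O := (origin d hq).

Lemma ground_walk_triangle i a b :
  a != zero hq -> b != zero hq -> a != b ->
  ground_walk hq [:: O; set_coord i a O; set_coord i b O; O].
Proof.
move=> a0 b0 ab; split.
  rewrite /= adj_set_coord ?ffunE 1?eq_sym // adj_set_coord2 //=.
  by rewrite adj_sym adj_set_coord ?ffunE 1?eq_sym.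
have axisE c : set_coord i c O = on_axis hq i c.
  by apply/ffunP=> j; rewrite !ffunE.
by exists i, a, b; rewrite !axisE.
Qed.

Lemma ground_walk_product_cons U W :
  ground_walk hq U -> ground_walk_product hq W ->
  ground_walk_product hq (walk_cat U W).
Proof.
move=> gU [Us gUs ->]; exists (U :: Us) => // V.
by rewrite inE => /predU1P[->|/gUs].
Qed.

Lemma ground_walk_product_head W :
  ground_walk_product hq W -> W = O :: behead W.
Proof.
case=> -[|U Us] gUs -> //=.
by have [|_ [i [a [b ->]]]] := gUs U; rewrite ?mem_head.
Qed.

(** Induction on the walk still to be read: the canonical path to its starting
    point stands for the part already read, so that the first edge can be
    absorbed into it. *)
Lemma canonical_path_closed x s :
  path adj x s -> last x s = O ->
  exists2 W, ground_walk_product hq W &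
    homotopic (O :: canonical_path O x (enum 'I_d) ++ s) W.
Proof.
elim: s x => [|y s IHs] x /=.
  move=> _ ->; exists [:: O]; first by exists [::].
  by rewrite canonical_path_refl; apply: homotopic_refl.
case/andP=> /adjE[i xyi ->].
set z := set_coord i (y i) x => zs /(IHs z zs)[W gW HW].
have [|t Ht Hxz] := canonical_path_edge O (enum_uniq 'I_d) _ xyi.
  by move=> j; rewrite mem_enum.
exists (t ++ W); last first.
  apply: homotopic_trans _ (homotopic_catl t HW).
  by have := homotopic_catr s Hxz; rewrite /= cat_rcons -catA.
case: Ht => [-> //|[-> x0 y0]].
have -> : [:: O; set_coord i (x i) O; set_coord i (y i) O] ++ W =
    walk_cat [:: O; set_coord i (x i) O; set_coord i (y i) O; O] W.
  by rewrite {1}(ground_walk_product_head gW).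
rewrite ffunE in x0 y0.
by apply: ground_walk_product_cons gW; apply: ground_walk_triangle.
Qed.

End Hamming.

Theorem theorem4p11 (d q : nat) (hd : 1 <= d) (hq : 2 < q)
    (W : seq (vertex d q))
    (W_walk : is_walk (@hamming_adj d q) W)
    (W_start : head (origin d hq) W = origin d hq)
    (W_end : last (origin d hq) W = origin d hq) :
  exists W' : seq (vertex d q),
    [/\ is_walk (@hamming_adj d q) W',
        ground_walk_product hq W' &
        walk_equiv (@hamming_adj d q) W W'].
Proof.
case: W => [//|w s] /= in W_walk W_start W_end *; subst w.
have [W' gW' HW'] := canonical_path_closed W_walk W_end.
have := HW' [::] [::].
rewrite canonical_path_refl /= !cats0 => /(_ W_walk)[walkW' equivW'].
by exists W'.
Qed.
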